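(* Every (finite) matroid $M$ admits a lean tree-decomposition of width $\mathrm{tw}(M)$.
   Context: Let $M$ be a matroid on ground set $E$ with rank function $r$. A tree-decomposition of $M$ (in the sense of Hliněný and Whittle) is a pair $(T,\tau)$ where $T$ is a finite tree and $\tau:E\to V(T)$ is an arbitrary map. For $v\in V(T)$, let $T_1,\dots,T_d$ be the components of $T-v$; the width of $v$ is $\sum_{i=1}^d r(E\setminus\tau^{-1}(V(T_i)))-(d-1)\,r(E)$. The width of $(T,\tau)$ is the maximum width of its vertices, and the tree-width $\mathrm{tw}(M)$ is the smallest width of a tree-decomposition of $M$. For $X\subseteq E$ let $\lambda(X)=r(X)+r(E\setminus X)-r(E)$. For subsets $Z_1,Z_2\subseteq E$ let $\lambda(Z_1,Z_2)=\min\{\lambda(X): Z_1\subseteq X,\ Z_2\subseteq E\setminus X\}$ (taken to be $+\infty$ if no such $X$ exists, i.e. if $Z_1\cap Z_2\neq\emptyset$). For an edge $ss'$ of $T$, let $T_1$ be the component of $T-s'$ containing $s$ and $T_2$ the component of $T-s$ containing $s'$; the edge $ss'$ induces the bipartition $(\tau^{-1}(V(T_1)),\tau^{-1}(V(T_2)))$ of $E$, and this is a ''$<k$ separation'' if $\lambda(\tau^{-1}(V(T_1)))<k$. The tree-decomposition $(T,\tau)$ is lean if for all $k\in\mathbb N$, all $t,t'\in V(T)$ and all subsets $Z_1\subseteq\tau^{-1}(t)$, $Z_2\subseteq\tau^{-1}(t')$ with $r(Z_1)=r(Z_2)=k$, either $\lambda(Z_1,Z_2)\ge k$ or there is an edge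 $ss'$ on the path $tTt'$ whose induced bipartition is a $<k$ separation. *)

(* Defs.v *)
From mathcomp Require Import all_boot all_order all_algebra.
From mathcomp Require Import boolp constructive_ereal.

Set Implicit Arguments.
Unset Strict Implicit.
Unset Printing Implicit Defensive.

Import Order.TTheory GRing.Theory Num.Theory.

Local Open Scope ring_scope.

(* The ground set is the whole finite type E. *)
Record matroid (E : finType) := Matroid {
  indep : pred {set E};
  indep0 : indep set0;
  indep_sub : forall I J : {set E}, J \subset I -> indep I -> indep J;
  indep_aug : forall I J : {set E}, indep I -> indep J -> (#|I| < #|J|)%N ->
    exists2 x, x \in J :\: I & indep (x |: I)
}.

Definition rank (E : finType) (M : matroid E) (X : {set E}) : nat :=
  \max_(I : {set E} | indep M I && (I \subset X)) #|I|.

Definition conn (E : finType) (M : matroid E) (X : {set E}) : int :=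
  (rank M X)%:Z + (rank M (~: X))%:Z - (rank M [set: E])%:Z.

Definition conn2 (E : finType) (M : matroid E) (Z1 Z2 : {set E}) : \bar int :=
  \big[Order.min/+oo%E]_(X : {set E} | (Z1 \subset X) && (Z2 \subset ~: X))
    (conn M X)%:E.

Record tree := Tree {
  vertex :> finType;
  adj : rel vertex;
  tree_nonempty : (0 < #|vertex|)%N;
  adj_sym : symmetric adj;
  adj_irr : irreflexive adj;
  tree_connected : forall x y, connect adj x y;
  (* a sequence of two adjacent vertices is a ucycle of a symmetric relation *)
  tree_acyclic : forall c : seq vertex, ucycle adj c -> (size c <= 2)%N
}.

Record tree_decomposition (E : finType) := TreeDecomposition {
  td_tree : tree;
  td_map : E -> td_tree
}.

Definition adj_minus (T : tree) (v : T) : rel T :=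
  [rel x y | [&& x != v, y != v & adj x y]].

(* The component of T - v containing u; only meaningful for u != v. *)
Definition component (T : tree) (v u : T) : {set T} :=
  [set w | connect (adj_minus v) u w].

Definition components (T : tree) (v : T) : {set {set T}} :=
  [set component v u | u in [set~ v]].

Definition td_preim (E : finType) (D : tree_decomposition E)
  (C : {set td_tree D}) : {set E} := [set x | td_map D x \in C].

Definition vertex_width (E : finType) (M : matroid E)
    (D : tree_decomposition E) (v : td_tree D) : int :=
  \sum_(C in components v) (rank M (~: td_preim C))%:Z
    - (#|components v|%:Z - 1) * (rank M [set: E])%:Z.

(* The default value 0 is harmless, see widthP below. *)
Definition width (E : finType) (M : matroid E) (D : tree_decomposition E) : int :=
  \big[Order.max/0]_(v : td_tree D) vertex_width M v.

Definition tree_path (T : tree) (t t' : T) (p : seq T) : Prop :=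
  [/\ path (@adj T) t p, uniq (t :: p) & last t p = t'].

Definition edge_on_path (T : tree) (t t' s s' : T) : Prop :=
  exists2 p : seq T, tree_path t t' p & infix [:: s; s'] (t :: p).

Definition lean (E : finType) (M : matroid E) (D : tree_decomposition E) : Prop :=
  forall (k : nat) (t t' : td_tree D) (Z1 Z2 : {set E}),
    Z1 \subset td_preim [set t] -> Z2 \subset td_preim [set t'] ->
    rank M Z1 = k -> rank M Z2 = k ->
    (k%:Z%:E <= conn2 M Z1 Z2)%E \/
    exists s s' : td_tree D, edge_on_path t t' s s' /\
      conn M (td_preim (component s' s)) < k%:Z.

Section RankFacts.
Variables (E : finType) (M : matroid E).
Implicit Types (I J X Y : {set E}).

Lemma rank_indep I X : indep M I -> I \subset X -> (#|I| <= rank M X)%N.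
Proof. by move=> iI sI; apply: leq_bigmax_cond; rewrite iI. Qed.

Lemma rank_basis X : exists I, [/\ indep M I, I \subset X & #|I| = rank M X].
Proof.
have h : (0 < #|[pred I : {set E} | indep M I && (I \subset X)]|)%N.
  by apply/card_gt0P; exists set0; rewrite inE indep0 sub0set.
by case: (eq_bigmax_cond (fun I : {set E} => #|I|) h) => I /andP[? ?] eI; exists I.
Qed.

Lemma indep_extend I X : indep M I -> I \subset X ->
  exists J, [/\ indep M J, I \subset J, J \subset X & #|J| = rank M X].
Proof.
move eqn: (rank M X - #|I|)%N => n.
elim: n I eqn => [|n IHn] I eqn iI sI.
  exists I; split=> //; apply/eqP; rewrite eqn_leq rank_indep //=.
  by rewrite -subn_eq0 eqn.
have [B [iB sB cB]] := rank_basis X.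
have ltIB : (#|I| < #|B|)%N by rewrite cB -subn_gt0 eqn.
have [x /setDP[xB xI] ixI] := indep_aug iI iB ltIB.
have sxI : x |: I \subset X by rewrite subUset sub1set (subsetP sB).
have [|J [iJ sJ sJX cJ]] := IHn (x |: I) _ ixI sxI.
  by rewrite cardsU1 xI add1n subnS eqn.
by exists J; split=> //; apply: subset_trans sJ; apply: subsetUr.
Qed.

Lemma rank_submod X Y :
  (rank M (X :|: Y) + rank M (X :&: Y) <= rank M X + rank M Y)%N.
Proof.
have [I [iI sI cI]] := rank_basis (X :&: Y).
have sIU : I \subset X :|: Y.
  by apply: (subset_trans sI); rewrite subIset // subsetUl.
have [J [iJ sIJ sJ cJ]] := indep_extend iI sIU.
have rX : (#|J :&: X| <= rank M X)%N.
  by rewrite rank_indep ?subsetIr // (indep_sub _ iJ) ?subsetIl.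
have rY : (#|J :&: Y| <= rank M Y)%N.
  by rewrite rank_indep ?subsetIr // (indep_sub _ iJ) ?subsetIl.
apply: leq_trans (leq_add rX rY).
rewrite -cardsUI -setIUr -setIIr (setIidPl sJ) cJ leq_add2l -cI.
by apply: subset_leq_card; rewrite subsetI sIJ.
Qed.

Lemma rank_coverC (s : seq {set E}) : pairwise (fun X Y : {set E} => [disjoint X & Y]) s ->
  (rank M (~: \bigcup_(X <- s) X) + size s * rank M [set: E] <=
   \sum_(X <- s) rank M (~: X) + rank M [set: E])%N.
Proof.
elim: s => [|X s IHs] /=; first by rewrite !big_nil setC0 mul0n addnC.
case/andP=> /allP dX /IHs {IHs}; set U := \bigcup_(Y <- s) Y => IHs.
have dXU : [disjoint X & U].
  rewrite /U big_seq; elim/big_ind: _ => [|A B dA dB|Y /dX //].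
    by rewrite -setI_eq0 setI0.
  by rewrite -setI_eq0 setIUr setU_eq0 !setI_eq0 dA.
rewrite !big_cons -/U setCU mulSn.
have := rank_submod (~: X) (~: U).
rewrite -setCI (disjoint_setI0 dXU) setC0.
set rE := rank M [set: E] in IHs *; set a := rank M (_ :&: _) => h.
rewrite addnA (addnC a) -addnA.
apply: leq_trans (_ : rank M (~: X) + (rank M (~: U) + size s * rE) <= _)%N.
  by rewrite !addnA leq_add2r.
by rewrite -addnA leq_add2l.
Qed.

End RankFacts.

Lemma components_disjoint (T : tree) (v : T) (A B : {set T}) :
  A \in components v -> B \in components v -> A != B -> [disjoint A & B].
Proof.
case/imsetP=> a _ -> /imsetP[b _ ->]; apply: contraR.
have cs : connect_sym (adj_minus v).
  apply: sym_connect_sym => x y /=.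
  by rewrite /adj_minus /= adj_sym; case: (x != v); case: (y != v).
rewrite -setI_eq0 => /set0Pn[w]; rewrite !inE => /andP[aw bw].
apply/eqP/setP=> z; rewrite !inE.
by rewrite (same_connect cs aw) (same_connect cs bw).
Qed.

Section WidthFacts.
Variables (E : finType) (M : matroid E).
Implicit Type D : tree_decomposition E.

Lemma vertex_width_ge0 D (v : td_tree D) : 0 <= vertex_width M v.
Proof.
have : pairwise (fun X Y : {set E} => [disjoint X & Y])
    [seq td_preim C | C <- enum (components v)].
  rewrite pairwise_map; apply: (@sub_in_pairwise _ (mem (components v)) (fun A B => A != B)).
  - move=> A B Av Bv nAB /=; have := components_disjoint Av Bv nAB.
    rewrite -!setI_eq0 => /eqP AB0; apply/eqP/setP=> x; rewrite !inE.
    by have /setP/(_ (td_map D x)) := AB0; rewrite !inE.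
  - by apply/allP=> A; rewrite mem_enum.
  - by rewrite -uniq_pairwise enum_uniq.
move=> /(rank_coverC M); rewrite size_map -cardE big_map [X in (_ <= X + _)%N]big_map.
rewrite !big_enum /= => h.
rewrite /vertex_width mulrBl mul1r opprB addrA subr_ge0 addrC -PoszM.
apply: le_trans (_ : (\sum_(C in components v) rank M (~: td_preim C)
    + rank M [set: E])%N%:Z <= _).
  by rewrite lez_nat; apply: leq_trans h; apply: leq_addl.
by rewrite PoszD addrC (big_morph Posz PoszD (erefl _)).
Qed.

Lemma width_ge0 D : 0 <= width M D.
Proof. exact: bigmax_ge_id. Qed.

Lemma widthP D : (forall v : td_tree D, vertex_width M v <= width M D) /\
  exists v : td_tree D, vertex_width M v = width M D.
Proof.
split=> [v|]; first exact: le_bigmax.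
have /card_gt0P[v0 _] := tree_nonempty (td_tree D).
have [|v _ eqv] := @eq_bigmax _ _ _ 0 v0 predT (@vertex_width E M D) isT.
  by move=> v _; apply: vertex_width_ge0.
by exists v; rewrite -eqv.
Qed.

End WidthFacts.

Lemma unit_nonempty : (0 < #|{: unit}|)%N.
Proof. by rewrite card_unit. Qed.

Lemma unit_connected (e : rel unit) x y : connect e x y.
Proof. by case: x; case: y. Qed.

Lemma unit_acyclic (c : seq unit) :
  ucycle (fun _ _ : unit => false) c -> (size c <= 2)%N.
Proof. by case: c => [|[] [|[] c]] //= /andP[]. Qed.

Definition unit_tree : tree :=
  @Tree unit (fun _ _ => false) unit_nonempty (fun _ _ => erefl)
    (fun _ => erefl) (unit_connected _) unit_acyclic.

Lemma ex_width (E : finType) (M : matroid E) :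
  exists n : nat, `[< exists D : tree_decomposition E, width M D = n%:Z >].
Proof.
pose D := TreeDecomposition (fun _ : E => (tt : unit_tree)).
exists `|width M D|%N; apply/asboolP; exists D.
by rewrite gez0_abs // width_ge0.
Qed.

(* All widths are nonnegative, so the least width is found by ex_minn. *)
Definition tw (E : finType) (M : matroid E) : nat := ex_minn (ex_width M).

Lemma twP (E : finType) (M : matroid E) :
  (exists D : tree_decomposition E, width M D = (tw M)%:Z) /\
  forall D : tree_decomposition E, (tw M)%:Z <= width M D.
Proof.
rewrite /tw; case: ex_minnP => n /asboolP exn minn; split=> // D.
rewrite -(gez0_abs (width_ge0 M D)) lez_nat; apply: minn.
by apply/asboolP; exists D; rewrite gez0_abs // width_ge0.
Qed.

(* Main.v *)
Require Import Defs.
From mathcomp Require Import all_boot all_order all_algebra.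
From mathcomp Require Import boolp constructive_ereal zify.

(** The argument follows Bellenbaum and Diestel. Write [deficit A := r E - r (E \ A)]:
    it is monotone and supermodular, the width of a vertex is [r E] minus the sum
    of the deficits of the parts behind the components at that vertex, and
    [conn X = r E - deficit X - deficit (E \ X)], so that an edge behaves like a vertex
    with two parts. Call the families of components arising at vertices and at edges
    stars.

    Take a decomposition of width [tw M] such that, reading [p] downwards, the number
    of stars of width at least [p] is lexicographically minimal. If it is not lean,
    witnessed by [k, t, t', Z1, Z2], let [X] separate [Z1] from [Z2] with [conn X]
    minimal and, subject to this, with as few sides of edges off the path from [t] to
    [t'] crossed as possible. Take two copies of the tree, put [X] in the first and its
    complement in the second, and join the vertex [t'] of the first to the vertex [t]
    of the second. Minimality of [conn X] shows that no star gets wider in either copy,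
    and minimal crossing that whenever one copy keeps its width, one of the two copies
    has width at most [conn X < k]. Finally some star of width at least [k] shrinks in
    both copies, contradicting the choice of the decomposition. *)

Set Implicit Arguments.
Unset Strict Implicit.
Unset Printing Implicit Defensive.

Import Order.TTheory GRing.Theory Num.Theory.

Lemma homo_connect (U V : finType) (e : rel U) (e' : rel V) (f : U -> V) :
  {homo f : x y / e x y >-> e' x y} ->
  {homo f : x y / connect e x y >-> connect e' x y}.
Proof.
move=> homo_f x y /connectP[p /(homo_path homo_f) fp ->].
by apply/connectP; exists [seq f z | z <- p]; rewrite ?last_map.
Qed.

Lemma path_exit (U : eqType) (e : rel U) (Q : pred U) x p :
  path e x p -> Q x -> ~~ Q (last x p) ->
  exists u v, [/\ infix [:: u; v] (x :: p), e u v, Q u & ~~ Q v].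
Proof.
elim: p x => [|y p IHp] x /=; first by move=> _ ->.
case/andP=> xy yp Qx nQ; have [Qy|nQy] := boolP (Q y).
  have [u [v [uv euv Qu Qv]]] := IHp y yp Qy nQ; exists u, v; split=> //.
  exact: infix_trans uv (infix_cons _ _).
by exists x, y; split=> //; rewrite /= !eqxx prefix0s.
Qed.

Lemma neq_negb (b c : bool) : c != b -> c = ~~ b.
Proof. by case: b c => -[]. Qed.

Lemma negb_neq (b : bool) : ~~ b != b.
Proof. by case: b. Qed.

Section Stem.
Variables (T : finType) (F : {set {set T}}).
Hypothesis trivF : trivIset F.
Implicit Types (s x : T) (C : {set T}).

(* The member of [F] containing [s], or the complement of [cover F] if there is none. *)
Definition stem s : {set T} := [set x | pblock F x == pblock F s].

Lemma mem_stem s : s \in stem s.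
Proof. by rewrite inE. Qed.

Lemma stem_block C s : C \in F -> s \in C -> stem s = C.
Proof.
move=> CF sC; apply/setP => x; have defC := def_pblock trivF CF sC.
by rewrite inE eq_sym eq_pblock ?defC // -mem_pblock defC.
Qed.

Lemma block_sub_stemC C s : C \in F -> s \notin C -> C \subset ~: stem s.
Proof.
move=> CF; apply: contraNT => /subsetPn[x xC]; rewrite inE negbK inE => eq_xs.
have defC := def_pblock trivF CF xC.
by rewrite -defC -eq_pblock // -mem_pblock defC.
Qed.

End Stem.

(** * Components and stars of a tree *)

Section TreeComponents.
Variable T : tree.
Implicit Types (u v w x y : T) (S C : {set T}) (p : seq T).

Lemma adj_neq x y : adj x y -> x != y.
Proof. by apply: contraTneq => ->; rewrite adj_irr. Qed.

Lemma adj_minus_connect_sym v : connect_sym (adj_minus v).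
Proof.
by apply: sym_connect_sym => x y; rewrite /adj_minus /= adj_sym andbCA.
Qed.

Lemma mem_component v u : u \in component v u.
Proof. by rewrite inE connect0. Qed.

Lemma component_eq v u w : w \in component v u -> component v w = component v u.
Proof.
rewrite inE => uw; apply/setP => z.
by rewrite !inE (same_connect (adj_minus_connect_sym v) uw).
Qed.

Lemma center_notin_component v u : u != v -> v \notin component v u.
Proof.
move=> uv; rewrite inE adj_minus_connect_sym; apply: contraNN uv => /connectP[].
by case=> [_ ->|w p] //=; rewrite /adj_minus /= eqxx.
Qed.

Lemma component_step v u x y :
  u != v -> x \in component v u -> adj x y -> y != v -> y \in component v u.
Proof.
move=> uv xu xy yv; have xv : x != v.
  by apply: contraNneq (center_notin_component uv) => {1}<-.
move: xu; rewrite !inE => /connect_trans; apply; apply: connect1.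
by rewrite /adj_minus /= xv yv.
Qed.

Lemma path_component v u p : path (@adj T) u p -> v \notin u :: p ->
  last u p \in component v u.
Proof.
elim/last_ind: p => [|p w IHp] /=; first by rewrite mem_component.
rewrite rcons_path last_rcons inE mem_rcons inE !negb_or => /andP[up pw].
case/and3P=> vu vw vp; have uv : u != v by rewrite eq_sym.
apply: component_step uv _ pw _; last by rewrite eq_sym.
by rewrite IHp // inE negb_or vu.
Qed.

Lemma component_sub v u x w : x \notin component v u -> w \in component v u ->
  component v u \subset component x w.
Proof.
move=> xC wC; apply/subsetP => z; rewrite -(component_eq wC) inE => /connectP[p wp ->].
apply: path_component; first by apply: sub_path wp => a b /and3P[].
apply: contraNN xC => xp; rewrite -(component_eq wC) inE.
exact: path_connect wp _ xp.
Qed.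

Definition del_edge x y : rel T :=
  [rel a b | adj a b && ((a, b) \notin [:: (x, y); (y, x)])].

Lemma connect_del_edge v x y : v \in [:: x; y] ->
  subrel (connect (adj_minus v)) (connect (del_edge x y)).
Proof.
move=> v_xy; apply: connect_sub => a b /and3P[/negPf av /negPf bv ab]; apply: connect1.
rewrite /del_edge /= ab !inE !xpair_eqE.
by move: v_xy; rewrite !inE => /orP[] /eqP <-; rewrite av bv andbF.
Qed.

Lemma del_edge_disconnects x y : adj x y -> ~~ connect (del_edge x y) y x.
Proof.
move=> xy; apply/negP => /connectP[_ /shortenP[p yp up _] def_x].
have adj_p : path (@adj T) y p by apply: sub_path yp => a b /andP[].
have : ucycle (@adj T) (y :: p).
  by rewrite /ucycle up andbT /= rcons_path adj_p -def_x xy.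
move/tree_acyclic; case: p yp def_x {up adj_p} => [_|z [|//]] /=.
  by move=> eq_xy; have := adj_neq xy; rewrite eq_xy eqxx.
by move=> + eq_xz; rewrite -eq_xz /del_edge /= !inE eqxx orbT andbF.
Qed.

Lemma componentC x y : adj x y -> component y x = ~: component x y.
Proof.
move=> xy; have nxy := adj_neq xy; have nyx : y != x by rewrite eq_sym.
apply/setP => w; rewrite [RHS]inE; apply/idP/idP => [wx|].
  apply/negP => wy; case/negP: (del_edge_disconnects xy).
  rewrite !inE in wx wy; apply: (@connect_trans _ _ w).
    by apply: (@connect_del_edge x); rewrite ?mem_head.
  apply: (@connect_del_edge y); first by rewrite !inE eqxx orbT.
  by rewrite adj_minus_connect_sym.
suff: w \in component x y :|: component y x by rewrite inE => /orP[->|].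
have closed_xy : closed (@adj T) (mem (component x y :|: component y x)).
  apply: intro_closed; first exact/sym_connect_sym/adj_sym.
  move=> a b ab; rewrite inE => /orP[] aC; rewrite inE.
    have [->|/(component_step nyx aC ab) -> //] := eqVneq b x.
    by rewrite mem_component orbT.
  have [->|/(component_step nxy aC ab) ->] := eqVneq b y; last by rewrite orbT.
  by rewrite mem_component.
by rewrite -(closed_connect closed_xy (tree_connected x w)) inE mem_component orbT.
Qed.

Lemma cover_components v : cover (components v) = [set~ v].
Proof.
apply/setP => w; rewrite cover_imset !inE; apply/bigcupP/idP => [[u uv wu]|wv].
  by rewrite !inE in uv; apply: contraTneq wu => ->; rewrite center_notin_component.
by exists w; rewrite ?mem_component // !inE.
Qed.

Lemma components_trivIset v : trivIset (components v).
Proof. by apply/trivIsetP => A B; apply: components_disjoint. Qed.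

Lemma component_in v u : u != v -> component v u \in components v.
Proof. by move=> uv; rewrite imset_f // !inE. Qed.

Lemma tree_path_ex x y : exists p, tree_path x y p.
Proof.
by have /connectP[_ /shortenP[p xp up _] ->] := tree_connected x y; exists p.
Qed.

Definition branches : {set {set T}} := [set component e.1 e.2 | e : T * T & adj e.1 e.2].

Lemma branchesP S :
  reflect (exists x y, adj x y /\ S = component x y) (S \in branches).
Proof.
apply: (iffP imsetP) => [[[x y]]|[x [y [xy ->]]]]; rewrite ?inE /=.
  by move=> xy ->; exists x, y.
by exists (x, y); rewrite ?inE.
Qed.

Lemma branch_component x y : adj x y -> component x y \in branches.
Proof. by move=> xy; apply/branchesP; exists x, y. Qed.

Lemma branchC S : S \in branches -> ~: S \in branches.
Proof.
by case/branchesP=> x [y [xy ->]]; rewrite -(componentC xy) branch_component // adj_sym.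
Qed.

Lemma branch_neqC S : S \in branches -> S != ~: S.
Proof.
case/branchesP=> x [y [_ ->]]; apply/negP => /eqP/setP/(_ y).
by rewrite in_setC mem_component.
Qed.

Lemma components_branches v : components v \subset branches.
Proof.
apply/subsetP => _ /imsetP[w wv ->]; rewrite !inE in wv.
have [[|u p] [vp up def_w]] := tree_path_ex v w; first by rewrite -def_w eqxx in wv.
case/andP: vp up def_w => vu up /andP[vp _] def_w.
suff -> : component v w = component v u by apply: branch_component.
by rewrite -def_w; apply/component_eq/path_component.
Qed.

Lemma components_nested v S : S \in branches ->
  exists2 C, C \in components v & (S \subset C) || (~: S \subset C).
Proof.
wlog vS : S / v \notin S => [IH Sb|/branchesP[x [y [xy defS]]]].
  have [vS|] := boolP (v \in S); last by move/IH; apply.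
  by have [||C Cv] := IH (~: S); rewrite ?inE ?vS ?branchC // setCK orbC; exists C.
have vy : y != v by apply: contraNneq vS => <-; rewrite defS mem_component.
exists (component v y); first exact: component_in.
by rewrite defS component_sub ?mem_component // -defS.
Qed.

(* Removing an edge leaves two parts, so an edge is treated like a vertex of degree
   two. *)
Definition stars : {set {set {set T}}} :=
  [set components v | v : T] :|: [set [set S; ~: S] | S in branches].

Lemma starsP F : F \in stars ->
  (exists v, F = components v) \/ (exists2 S, S \in branches & F = [set S; ~: S]).
Proof. by rewrite inE => /orP[] /imsetP[z z_in ->]; [left|right]; exists z. Qed.

Lemma components_star v : components v \in stars.
Proof. by apply/setUP; left; apply/imsetP; exists v. Qed.

Lemma edge_star S : S \in branches -> [set S; ~: S] \in stars.
Proof. by move=> Sb; apply/setUP; right; apply/imsetP; exists S. Qed.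

Lemma star_trivIset F : F \in stars -> trivIset F.
Proof.
case/starsP=> [[v ->]|[S _ ->]]; first exact: components_trivIset.
apply/trivIsetP => A B; rewrite !inE -setI_eq0.
by case/orP=> /eqP ->; case/orP=> /eqP ->; rewrite ?eqxx ?setICr // setIC setICr eqxx.
Qed.

Lemma star_branches F : F \in stars -> F \subset branches.
Proof.
case/starsP=> [[v ->]|[S Sb ->]]; first exact: components_branches.
by rewrite subUset !sub1set Sb branchC.
Qed.

Lemma star_nested F S : F \in stars -> S \in branches ->
  exists2 C, C \in F & (S \subset C) || (~: S \subset C).
Proof.
case/starsP=> [[v ->]|[R /branchesP[x [y [xy defR]]] ->]]; first exact: components_nested.
case/(components_nested x) => C Cx subC; have [eqCR|neqCR] := eqVneq C R.
  by exists R; rewrite ?set21 -?eqCR.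
exists (~: R); first by rewrite set22.
have CR : C \subset ~: R.
  rewrite -disjoints_subset; apply: components_disjoint Cx _ neqCR.
  by rewrite defR component_in // eq_sym adj_neq.
by case/orP: subC => /subset_trans/(_ CR) ->; rewrite ?orbT.
Qed.

Lemma branch_laminar F S s : F \in stars -> S \in branches -> s \notin S ->
  [\/ S \subset ~: stem F s, [disjoint S & ~: stem F s] | ~: stem F s \subset S].
Proof.
move=> Fs Sb sS; have trivF := star_trivIset Fs.
have [C CF /orP[SC|SC]] := star_nested Fs Sb.
  have [sC|sC] := boolP (s \in C); last first.
    by constructor 1; apply: subset_trans SC (block_sub_stemC trivF CF sC).
  by constructor 2; rewrite disjoints_subset setCK (stem_block trivF CF sC).
have sC : s \in C by rewrite (subsetP SC) // inE.
by constructor 3; rewrite (stem_block trivF CF sC) subCset.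
Qed.

End TreeComponents.

(** * Joining two copies of a tree by an edge *)

Section Glue.
Variables (T : tree) (a : bool -> T).
Implicit Types (x y z : T * bool) (b c : bool) (u v w : T) (C R : {set T}).

Definition glue_adj : rel (T * bool) := fun x y =>
  if x.2 == y.2 then adj x.1 y.1 else (x.1 == a x.2) && (y.1 == a y.2).

Lemma glue_adj_copy b u w : glue_adj (u, b) (w, b) = adj u w.
Proof. by rewrite /glue_adj eqxx. Qed.

Lemma glue_adj_cross x y : glue_adj x y -> x.2 != y.2 ->
  x = (a x.2, x.2) /\ y = (a y.2, y.2).
Proof.
case: x y => u b [w c] /=; rewrite /glue_adj /= => + /negPf bc.
by rewrite bc => /andP[/eqP -> /eqP ->].
Qed.

Lemma glue_adj_anchors b : glue_adj (a b, b) (a (~~ b), ~~ b).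
Proof. by rewrite /glue_adj /= eq_sym (negPf (negb_neq b)) !eqxx. Qed.

Lemma glue_adj_sym : symmetric glue_adj.
Proof. by move=> x y; rewrite /glue_adj eq_sym adj_sym andbC. Qed.

Lemma glue_adj_irr : irreflexive glue_adj.
Proof. by move=> x; rewrite /glue_adj eqxx adj_irr. Qed.

Lemma glue_nonempty : (0 < #|{: T * bool}|)%N.
Proof. by rewrite card_prod card_bool muln_gt0 tree_nonempty. Qed.

Lemma glue_connected x y : connect glue_adj x y.
Proof.
have copy b u w : connect glue_adj (u, b) (w, b).
  apply: (@homo_connect _ _ (@adj T) _ (fun u => (u, b))) (tree_connected u w).
  by move=> u1 u2; rewrite glue_adj_copy.
case: x y => u b [w c]; have [<-|] := eqVneq c b; first exact: copy.
move=> /neq_negb ->; apply: connect_trans (copy b u (a b)) _.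
exact: connect_trans (connect1 (glue_adj_anchors b)) (copy _ _ w).
Qed.

Lemma glue_ucycle_copy (s : seq (T * bool)) : ucycle glue_adj s ->
  {in s &, forall x y, x.2 == y.2} -> (size s <= 2)%N.
Proof.
case/andP=> cyc us copy; rewrite -(size_map fst); apply: tree_acyclic.
apply/andP; split; last first.
  rewrite map_inj_in_uniq // => -[u b] [w c] us_ ws_ /= ->.
  by have /eqP /= -> := copy _ _ us_ ws_.
apply: (@homo_cycle_in _ _ (mem s)) cyc; last by apply/allP.
by move=> x y xs ys; rewrite /glue_adj copy.
Qed.

(* A cycle meeting both copies has two consecutive vertices in different copies, and
   has to use the same edge to return. *)
Lemma glue_acyclic (s : seq (T * bool)) : ucycle glue_adj s -> (size s <= 2)%N.
Proof.
move=> cs; have /andP[cyc us] := cs; pose same := [rel x y : T * bool | x.2 == y.2].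
have [same_s|cross] := boolP (cycle same s).
  apply: glue_ucycle_copy cs _; apply/allrelP; rewrite -cycle_all2rel //.
  by move=> y x z /= /eqP ->.
have /allPn[x xs] : ~~ all (fun x => same x (next s x)) s.
  by apply: contraNN cross => /allP; apply: cycle_from_next.
have [i p def_s] := rot_to xs.
rewrite -(next_rot i us) -(size_rot i) def_s.
have {cyc} : cycle glue_adj (x :: p) by rewrite -def_s rot_cycle.
have {us} : uniq (x :: p) by rewrite -def_s rot_uniq.
case: p {def_s} => [|y p] //= /and3P[x_yp y_p _] /andP[xy yp]; rewrite eqxx => neq_xy.
have [||u [v [/infixP[p1 [p2]] + uv ux vx]]] := path_exit (Q := fun z => z.2 != x.2) yp.
- by rewrite eq_sym.
- by rewrite last_rcons eqxx.
have [defx defy] := glue_adj_cross xy neq_xy.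
have [defu defv] : u = (a u.2, u.2) /\ v = (a v.2, v.2).
  by apply: glue_adj_cross uv _; rewrite (eqP (negbNE vx)).
have -> : v = x by rewrite defv defx (eqP (negbNE vx)).
have -> : u = y by rewrite defu defy (neq_negb ux) (@neq_negb x.2 y.2) // eq_sym.
case: p1 => [|z p1] /= [] => [|_ def_p]; last first.
  have : y \in rcons p x by rewrite def_p mem_cat mem_head orbT.
  by rewrite mem_rcons inE (negPf y_p) orbF => /eqP eq_yx; rewrite eq_yx eqxx in neq_xy.
case: p x_yp {yp y_p} => //= z p; rewrite !inE => + [eq_zx].
by rewrite eq_zx eqxx orbT.
Qed.

Definition glue : tree :=
  Tree glue_nonempty glue_adj_sym glue_adj_irr glue_connected glue_acyclic.

(* [C] in copy [b], together with the other copy if [C] contains the vertex at which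
   that copy is attached. *)
Definition glue_lift b C : {set glue} :=
  [set z | if z.2 == b then z.1 \in C else a b \in C].

Definition glue_copy b : {set glue} := [set z | z.2 == b].

Lemma glue_liftC b C : glue_lift b (~: C) = ~: glue_lift b C.
Proof. by apply/setP => z; rewrite !inE; case: ifP. Qed.

Lemma glue_lift_inj b : injective (glue_lift b).
Proof.
move=> C C' /setP eqC; apply/setP => u.
by have := eqC (u, b); rewrite !inE /= eqxx.
Qed.

Lemma glue_connect_copy b v u w : connect (adj_minus v) u w ->
  connect (@adj_minus glue (v, b)) (u, b) (w, b).
Proof.
apply: homo_connect (fun u => (u, b)) _ u w => x y /and3P[xv yv xy].
by rewrite /adj_minus /= glue_adj_copy !xpair_eqE !eqxx !andbT xv yv.
Qed.

Lemma glue_connect_other b c v u w : c != b ->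
  connect (@adj_minus glue (v, b)) (u, c) (w, c).
Proof.
move=> cb; apply: homo_connect (fun u => (u, c)) _ u w (tree_connected u w) => x y xy.
by rewrite /adj_minus /= glue_adj_copy !xpair_eqE (negPf cb) !andbF.
Qed.

Lemma glue_connect_across b v u : v != a b ->
  connect (@adj_minus glue (v, b)) (a b, b) (u, ~~ b).
Proof.
move=> vb; apply: connect_trans (glue_connect_other _ (a (~~ b)) _ (negb_neq b)).
apply: connect1; rewrite /adj_minus /= glue_adj_anchors !xpair_eqE eqxx !andbT.
by rewrite (eq_sym (a b)) vb (negPf (negb_neq b)) andbF.
Qed.

Lemma glue_component b v u : u != v ->
  @component glue (v, b) (u, b) = glue_lift b (component v u).
Proof.
move=> uv; have vC := center_notin_component uv.
have closed_lift :
    closed (@adj_minus glue (v, b)) (mem (glue_lift b (component v u))).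
  apply: (@intro_closed glue); first exact: adj_minus_connect_sym.
  move=> [x c] [y c'] /and3P[/= _ yv xy]; rewrite !in_set /=.
  have [eq_c|neq_c] := eqVneq c c'; last first.
    have [[->] [->]] := glue_adj_cross xy neq_c.
    by case: eqP => [->|_]; case: eqP => [->|_].
  move: xy yv; rewrite -eq_c glue_adj_copy; have [->|//] := eqVneq c b.
  rewrite xpair_eqE eqxx andbT => xy yv ux.
  by have := component_step uv _ xy yv; rewrite !inE; apply.
apply/setP => -[w c]; rewrite inE; apply/idP/idP => [uw|].
  by rewrite -(closed_connect closed_lift uw) inE /= eqxx mem_component.
rewrite inE /=; have [-> uw|/neq_negb -> ub] := eqVneq c b.
  by rewrite inE in uw; exact: glue_connect_copy.
have vb : v != a b by apply: contraNneq vC => {1}->.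
rewrite inE in ub.
exact: connect_trans (glue_connect_copy b ub) (glue_connect_across _ vb).
Qed.

Lemma glue_component_across b v u : v != a b ->
  @component glue (v, b) (u, ~~ b) = glue_lift b (component v (a b)).
Proof.
move=> vb; rewrite -glue_component 1?eq_sym //; apply: component_eq.
by rewrite inE glue_connect_across.
Qed.

Lemma glue_component_anchor b u :
  @component glue (a b, b) (u, ~~ b) = glue_copy (~~ b).
Proof.
have closed_copy : closed (@adj_minus glue (a b, b)) (mem (glue_copy (~~ b))).
  apply: (@intro_closed glue); first exact: adj_minus_connect_sym.
  move=> x y /and3P[/= _ yb xy]; rewrite !inE => /eqP xb; apply/eqP.
  apply: contraNeq yb => neq_y; have {}neq_y : y.2 = b by case: b y.2 neq_y {xb} => -[].
  by have [|_ ->] := glue_adj_cross xy; rewrite ?xb neq_y ?negb_neq.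
apply/setP => -[w c]; rewrite inE; apply/idP/idP => [uw|].
  by rewrite -(closed_connect closed_copy uw) inE.
by rewrite inE => /eqP /= ->; apply/glue_connect_other/negb_neq.
Qed.

Definition glue_star b (F : {set {set T}}) : {set {set glue}} :=
  glue_lift b @: F :|: (if a b \in cover F then set0 else [set glue_copy (~~ b)]).

Lemma glue_components b v : components ((v, b) : glue) = glue_star b (components v).
Proof.
rewrite /glue_star cover_components in_setC1; apply/setP => C; rewrite inE.
apply/imsetP/idP => [[[u c]]|].
  rewrite !inE xpair_eqE; have [-> |/neq_negb -> _] := eqVneq c b.
    rewrite andbT => uv ->; rewrite glue_component //.
    by rewrite imset_f ?component_in.
  have [<-|vb] := eqVneq (a b) v.
    by rewrite glue_component_anchor => ->; rewrite set11 orbT.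
  rewrite glue_component_across 1?eq_sym // => ->.
  by rewrite imset_f ?component_in.
case/orP => [/imsetP[_ /imsetP[u uv ->] ->]|].
  rewrite !inE in uv; exists (u, b); last by rewrite glue_component.
  by rewrite !inE xpair_eqE eqxx andbT.
case: eqVneq => [eq_v|_]; rewrite !inE // => /eqP ->.
exists (v, ~~ b); last by rewrite -{1}eq_v glue_component_anchor.
by rewrite !inE xpair_eqE (negPf (negb_neq b)) andbF.
Qed.

Lemma glue_branch (S : {set glue}) : S \in branches glue ->
  (exists b, S = glue_copy b) \/ (exists b R, R \in branches T /\ S = glue_lift b R).
Proof.
case/branchesP=> -[u b] [[w c] [uw ->]]; have [eq_c|neq_c] := eqVneq b c.
  rewrite /= -eq_c glue_adj_copy in uw *; right; exists b, (component u w).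
  by rewrite branch_component ?glue_component // eq_sym adj_neq.
left; exists (~~ b); have /= [[->] _] := glue_adj_cross uw neq_c.
by rewrite (@neq_negb b c) ?glue_component_anchor // eq_sym.
Qed.

Lemma glue_edge_star b R :
  glue_star b [set R; ~: R] = [set glue_lift b R; ~: glue_lift b R].
Proof.
rewrite /glue_star imsetU1 imset_set1 glue_liftC.
suff -> : a b \in cover [set R; ~: R] by rewrite setU0.
by rewrite /cover bigcup_setU !big_set1 setUCr inE.
Qed.

Lemma glue_starsP G : G \in stars glue ->
  (exists b F, F \in stars T /\ G = glue_star b F) \/
  (exists b, G = [set glue_copy b; ~: glue_copy b]).
Proof.
case/starsP=> [[[v b] ->]|[S /glue_branch[[b ->]|[b [R [Rb ->]]]] ->]].
- by left; exists b, (components v); rewrite components_star glue_components.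
- by right; exists b.
- by left; exists b, [set R; ~: R]; rewrite edge_star ?glue_edge_star.
Qed.

Lemma glue_copy_notin b F : F \in stars T -> glue_copy (~~ b) \notin glue_lift b @: F.
Proof.
move=> Fs; apply/imsetP => -[C CF /setP eqC].
have /branchesP[x [y [_ defC]]] := subsetP (star_branches Fs) C CF.
have := eqC (y, b); rewrite !in_set /= eqxx defC mem_component.
by rewrite eq_sym (negPf (negb_neq b)).
Qed.

End Glue.

Local Open Scope ring_scope.

(** * Rank deficits *)

Section Deficit.
Variables (E : finType) (M : matroid E).
Implicit Types (A B W X : {set E}).

Lemma rank_mono A B : A \subset B -> (rank M A <= rank M B)%N.
Proof.
move=> sAB; have [I [iI sI <-]] := rank_basis M A.
by apply: rank_indep => //; apply: subset_trans sAB.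
Qed.

Lemma rank_set0 : rank M set0 = 0%N.
Proof.
by have [I [_ sI <-]] := rank_basis M set0; apply/eqP; rewrite cards_eq0 -subset0.
Qed.

Definition deficit A : int := (rank M [set: E])%:Z - (rank M (~: A))%:Z.

Lemma deficit0 : deficit set0 = 0.
Proof. by rewrite /deficit setC0 subrr. Qed.

Lemma deficitT : deficit [set: E] = (rank M [set: E])%:Z.
Proof. by rewrite /deficit setCT rank_set0 subr0. Qed.

Lemma deficit_mono A B : A \subset B -> deficit A <= deficit B.
Proof. by rewrite -setCS /deficit => /rank_mono; lia. Qed.

Lemma deficit_ge0 A : 0 <= deficit A.
Proof. by rewrite -deficit0 deficit_mono // sub0set. Qed.

Lemma deficit_supermod A B :
  deficit A + deficit B <= deficit (A :|: B) + deficit (A :&: B).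
Proof.
by have := rank_submod M (~: A) (~: B); rewrite -setCU -setCI /deficit; lia.
Qed.

Lemma connE X : conn M X = (rank M [set: E])%:Z - deficit X - deficit (~: X).
Proof. by rewrite /conn /deficit setCK; lia. Qed.

Lemma connC X : conn M (~: X) = conn M X.
Proof. by rewrite !connE setCK; lia. Qed.

Lemma conn_ge0 X : 0 <= conn M X.
Proof.
by have := deficit_supermod X (~: X); rewrite setUCr setICr deficit0 deficitT connE; lia.
Qed.

Section DisjointFamily.
Variables (I : finType) (P : {set I}) (F : I -> {set E}).
Hypothesis disjF : {in P &, forall i j, i != j -> [disjoint F i & F j]}.

Lemma deficit_gain_sum A : \sum_(i in P) (deficit (A :|: F i) - deficit A) <=
  deficit (A :|: \bigcup_(i in P) F i) - deficit A.
Proof.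
rewrite -!big_enum /=.
have: {subset enum P <= P} by move=> i; rewrite mem_enum.
elim: (enum P) (enum_uniq (mem P)) => [|i s IHs] /=.
  by rewrite !big_nil setU0 subrr.
case/andP => i_s us sP; rewrite !big_cons; set U := \bigcup_(j <- s) F j.
have {}IHs : \sum_(j <- s) (deficit (A :|: F j) - deficit A) <=
    deficit (A :|: U) - deficit A.
  by apply: IHs => // j js; apply: sP; rewrite inE js orbT.
have FU : F i :&: U = set0.
  apply: disjoint_setI0; rewrite /U bigcup_seq; apply: bigcup_disjoint => j js.
  apply: disjF; rewrite ?sP ?mem_head // ?inE ?js ?orbT //.
  by apply: contraNneq i_s => ->.
have := deficit_supermod (A :|: F i) (A :|: U); rewrite -setUIr FU setU0 setUACA setUid.
by move: IHs; set S := \sum_(j <- s) _; lia.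
Qed.

Lemma deficit_sum : \sum_(i in P) deficit (F i) <= deficit (\bigcup_(i in P) F i).
Proof.
have := deficit_gain_sum set0; rewrite set0U deficit0 subr0.
by rewrite (eq_bigr (fun i => deficit (F i))) // => i _; rewrite set0U subr0.
Qed.

(* Supermodularity bounds the loss of each [F i] by its gain over [X], the gains
   add up to at most that of [W], and the gain of [B] pays for [~: X]. *)
Lemma deficit_exchange B W X :
  (forall i, i \in P -> F i \subset W) -> [disjoint B & W] ->
  \sum_(i in P) deficit (F i) + deficit B + conn M (X :|: W) <=
  \sum_(i in P) deficit (F i :&: X) + deficit (B :|: ~: X) + conn M X.
Proof.
move=> FW BW.
have loss : \sum_(i in P) deficit (F i) - \sum_(i in P) deficit (F i :&: X) <=
    \sum_(i in P) (deficit (X :|: F i) - deficit X).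
  rewrite -sumrB; apply: ler_sum => i _.
  by have := deficit_supermod (F i) X; rewrite (setUC (F i)); lia.
have gain : \sum_(i in P) (deficit (X :|: F i) - deficit X) <=
    deficit (X :|: W) - deficit X.
  apply: le_trans (deficit_gain_sum X) _; rewrite lerD2r.
  by apply/deficit_mono/setUS/bigcupsP.
have pay := deficit_supermod B (~: X).
have rest : deficit (B :&: ~: X) <= deficit (~: X :&: ~: W).
  by apply: deficit_mono; rewrite setIC setIS // -disjoints_subset.
by rewrite !connE setCU; lia.
Qed.

End DisjointFamily.
End Deficit.

(** * Widths of stars *)

Section StarWidth.
Variables (E : finType) (M : matroid E) (D : tree_decomposition E).
Notation T := (td_tree D).
Notation pre := (@td_preim E D).
Notation d := (deficit M).
Implicit Types (s t u v : T) (C S : {set T}) (F : {set {set T}}) (X Z : {set E}).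

Lemma td_preimS S C : S \subset C -> pre S \subset pre C.
Proof. by move=> /subsetP sSC; apply/subsetP => e; rewrite !inE => /sSC. Qed.

Lemma td_preimC C : pre (~: C) = ~: pre C.
Proof. by apply/setP => e; rewrite !inE. Qed.

Lemma td_preim_disjoint S C : [disjoint S & C] -> [disjoint pre S & pre C].
Proof. by rewrite !disjoints_subset -td_preimC; apply: td_preimS. Qed.

Lemma trivIset_preim_disjoint F : trivIset F ->
  {in F &, forall C C', C != C' -> [disjoint pre C & pre C']}.
Proof.
move=> /trivIsetP disjF C C' CF C'F neqC.
exact: td_preim_disjoint (disjF _ _ CF C'F neqC).
Qed.

Definition star_width F : int :=
  (rank M [set: E])%:Z - \sum_(C in F) d (pre C).

Lemma vertex_widthE v : vertex_width M v = star_width (components v).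
Proof.
rewrite /vertex_width /star_width /deficit sumrB sumr_const -mulr_natl natz mulrBl mul1r.
by rewrite !opprB addrCA.
Qed.

Lemma edge_star_width S : S != ~: S -> star_width [set S; ~: S] = conn M (pre S).
Proof.
move=> neqS; rewrite /star_width big_setU1 ?inE //= big_set1 td_preimC connE.
by rewrite opprD addrA.
Qed.

Lemma rank_le_star_width F Z : trivIset F -> Z \subset pre (~: cover F) ->
  (rank M Z)%:Z <= star_width F.
Proof.
move=> trivF sZ; rewrite /star_width.
have sum_le := deficit_sum M (trivIset_preim_disjoint trivF).
have : d (\bigcup_(C in F) pre C) <= d (~: Z).
  apply/deficit_mono/bigcupsP => C CF; rewrite subsetC; apply: subset_trans sZ _.
  by rewrite -td_preimC td_preimS // setCS bigcup_sup.
by move: sum_le; rewrite [d (~: Z)]/deficit setCK; set S := \sum_(C in _) _; lia.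
Qed.

Lemma conn_le_star_width F C : trivIset F -> C \in F -> conn M (pre C) <= star_width F.
Proof.
move=> trivF CF; rewrite /star_width connE (big_setD1 _ CF) /=.
have sum_le := deficit_sum M (trivIset_preim_disjoint (trivIsetS (subD1set F C) trivF)).
have : d (\bigcup_(C' in F :\ C) pre C') <= d (~: pre C).
  apply/deficit_mono/bigcupsP => C' /setD1P[C'C C'F].
  by rewrite -disjoints_subset (trivIset_preim_disjoint trivF).
by move: sum_le; set S := \sum_(C' in _) _; set U := \bigcup_(C' in _) _; lia.
Qed.

Lemma conn_le_vertex_width v u :
  adj v u -> conn M (pre (component v u)) <= vertex_width M v.
Proof.
move=> vu; rewrite vertex_widthE conn_le_star_width ?components_trivIset //.
by rewrite component_in // eq_sym adj_neq.
Qed.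

(* The elements behind [C] once those outside [X] have been moved to a new leaf
   attached to [s]. *)
Definition push s X C : {set E} :=
  if s \in C then pre C :|: ~: X else pre C :&: X.

(* If no part of [F] contains [s], then [F] is attached to the new leaf itself, which
   becomes a further part. *)
Definition push_width s X F : int :=
  (rank M [set: E])%:Z - \sum_(C in F) d (push s X C)
    - (if s \in cover F then 0 else d (~: X)).

Lemma push_width_exchange s X F : trivIset F ->
  push_width s X F + conn M (X :|: pre (~: stem F s)) <= star_width F + conn M X.
Proof.
move=> trivF; rewrite /push_width /star_width.
have push_out C : s \notin C -> push s X C = pre C :&: X by rewrite /push => /negPf ->.
case: ifPn => [/bigcupP[C CF sC]|s_cover].
  have out C' : C' \in F :\ C -> s \notin C'.
    case/setD1P=> neqC C'F; apply: contraNN neqC => sC'.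
    by rewrite -(def_pblock trivF CF sC) (def_pblock trivF C'F sC').
  have -> : stem F s = C := stem_block trivF CF sC.
  rewrite !(big_setD1 _ CF) /= {1}/push sC.
  rewrite (eq_bigr (fun C' => d (pre C' :&: X))); last by move=> C' /out/push_out ->.
  have disjW : [disjoint pre C & pre (~: C)].
    by rewrite disjoints_subset td_preimC setCK.
  have subW C' : C' \in F :\ C -> pre C' \subset pre (~: C).
    case/setD1P=> neqC C'F; rewrite td_preimC -disjoints_subset.
    exact: (trivIset_preim_disjoint trivF).
  have disj := trivIset_preim_disjoint (trivIsetS (subD1set F C) trivF).
  have := deficit_exchange M disj X subW disjW.
  by set S := \sum_(C' in _) _; set S' := \sum_(C' in _) _; lia.
have out C : C \in F -> s \notin C.
  by move=> CF; apply: contraNN s_cover => sC; apply/bigcupP; exists C.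
rewrite (eq_bigr (fun C => d (pre C :&: X))); last by move=> C /out/push_out ->.
have disjW : [disjoint set0 & pre (~: stem F s)] by rewrite disjoints_subset sub0set.
have subW C : C \in F -> pre C \subset pre (~: stem F s).
  by move=> CF; apply/td_preimS/block_sub_stemC; rewrite ?out.
have := deficit_exchange M (trivIset_preim_disjoint trivF) X subW disjW.
rewrite set0U deficit0.
by set S := \sum_(C in _) _; set S' := \sum_(C in _) _; lia.
Qed.

Lemma sum_trivIset_mem F t (a : int) : trivIset F ->
  \sum_(C in F) (if t \in C then a else 0) = if t \in cover F then a else 0.
Proof.
move=> trivF; case: ifPn => [/bigcupP[C CF tC]|t_cover]; last first.
  rewrite big1 // => C CF; case: ifP => // tC.
  by case/bigcupP: t_cover; exists C.
rewrite (big_setD1 _ CF) /= tC big1 ?addr0 // => C' /setD1P[neqC C'F].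
case: ifP => // tC'; case/eqP: neqC.
by rewrite -(def_pblock trivF CF tC) (def_pblock trivF C'F tC').
Qed.

Definition uncrossed X S : bool := (pre S \subset X) || (pre S \subset ~: X).

Lemma uncrossedC X S : uncrossed (~: X) S = uncrossed X S.
Proof. by rewrite /uncrossed setCK orbC. Qed.

Lemma push_width_add_le t t' X F : trivIset F ->
  (forall C, C \in F -> t \in C -> t' \notin C) ->
  (forall C, C \in F -> t \notin C -> t' \notin C -> uncrossed X C) ->
  push_width t' X F + push_width t (~: X) F <= star_width F + conn M X.
Proof.
move=> trivF sep_tt' unc; rewrite connE /push_width /star_width setCK.
suff : \sum_(C in F) (d (pre C) + (if t \in C then d X else 0)
        + (if t' \in C then d (~: X) else 0)) <=
    \sum_(C in F) (d (push t' X C) + d (push t (~: X) C)).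
  by rewrite !big_split /= !sum_trivIset_mem //; do 2 case: ifP => _; lia.
apply: ler_sum => C CF; rewrite /push setCK; case: (boolP (t \in C)) => tC.
  by rewrite (negPf (sep_tt' _ CF tC)); have := deficit_supermod M (pre C) X; lia.
case: (boolP (t' \in C)) => t'C.
  by have := deficit_supermod M (pre C) (~: X); lia.
case/orP: (unc _ CF tC t'C) => /setIidPl ->.
  by have := deficit_ge0 M (pre C :&: ~: X); lia.
by have := deficit_ge0 M (pre C :&: X); lia.
Qed.

Lemma push_width_le0 s X F C : C \in F -> s \in C -> pre (~: C) \subset ~: X ->
  push_width s X F <= 0.
Proof.
move=> CF sC sub; rewrite /push_width (big_setD1 _ CF) /=.
have -> : push s X C = [set: E].
  apply/eqP; rewrite /push sC -subTset -(setUCr (pre C)) -td_preimC.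
  exact: setUS.
have : 0 <= \sum_(C' in F :\ C) d (push s X C').
  by apply: sumr_ge0 => C' _; apply: deficit_ge0.
rewrite deficitT; set S := \sum_(C' in _) _.
by have := deficit_ge0 M (~: X); case: ifP => _; lia.
Qed.

End StarWidth.

(** * The choice of the separation *)

Definition separates (E : finType) (Z1 Z2 X : {set E}) : bool :=
  (Z1 \subset X) && (Z2 \subset ~: X).

Lemma separatesC (E : finType) (Z1 Z2 X : {set E}) :
  separates Z2 Z1 (~: X) = separates Z1 Z2 X.
Proof. by rewrite /separates setCK andbC. Qed.

Lemma conn2_lt (E : finType) (M : matroid E) (k : nat) (Z1 Z2 : {set E}) :
  ~~ (k%:Z%:E <= conn2 M Z1 Z2)%E -> exists2 X, separates Z1 Z2 X & conn M X < k%:Z.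
Proof.
apply: contraNP => none; apply/bigmin_geP; split=> [|X sX]; first exact: leey.
by rewrite lee_fin leNgt; apply/negP => ltX; apply: none; exists X.
Qed.

Section OptimalSeparation.
Variables (E : finType) (M : matroid E) (D : tree_decomposition E).
Notation T := (td_tree D).
Notation pre := (@td_preim E D).
Implicit Types (t : T) (C S : {set T}) (F : {set {set T}}) (X Y Z : {set E}).

(* A branch containing neither [t] nor [t'] is a side of an edge off the path from [t]
   to [t']. *)
Definition off_path t t' : {set {set T}} :=
  [set S in branches T | (t \notin S) && (t' \notin S)].

Definition uncrossed_off_path t t' X : {set {set T}} :=
  [set S in off_path t t' | uncrossed X S].

Definition optimal t t' Z1 Z2 X : Prop :=
  [/\ separates Z1 Z2 X,
      forall Y, separates Z1 Z2 Y -> conn M X <= conn M Y &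
      forall Y, separates Z1 Z2 Y -> conn M Y = conn M X ->
        (#|uncrossed_off_path t t' Y| <= #|uncrossed_off_path t t' X|)%N].

Lemma uncrossed_off_pathC t t' X :
  uncrossed_off_path t' t (~: X) = uncrossed_off_path t t' X.
Proof. by apply/setP => S; rewrite !inE uncrossedC [(t' \notin _) && _]andbC. Qed.

Lemma optimal_sym t t' Z1 Z2 X : optimal t t' Z1 Z2 X -> optimal t' t Z2 Z1 (~: X).
Proof.
case=> sX minX maxX; split=> [|Y|Y]; first by rewrite separatesC.
  by rewrite -{1}(setCK Y) separatesC connC -(connC M Y) => /minX.
rewrite -{1}(setCK Y) separatesC connC -(connC M Y) uncrossed_off_pathC.
by rewrite -{3}(setCK Y) uncrossed_off_pathC; apply: maxX.
Qed.

Lemma optimal_ex t t' Z1 Z2 X0 : separates Z1 Z2 X0 ->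
  exists2 X, optimal t t' Z1 Z2 X & conn M X <= conn M X0.
Proof.
move=> sX0; have [X sX minX] := arg_minP (conn M) sX0.
have PX : separates Z1 Z2 X && (conn M X == conn M X) by rewrite sX eqxx.
have [Y /andP[sY /eqP eqY] maxY] :=
  @arg_maxnP _ X (fun Y => separates Z1 Z2 Y && (conn M Y == conn M X))
    (fun Y => #|uncrossed_off_path t t' Y|) PX.
exists Y; last by rewrite eqY minX.
split=> // [V|V sV eqV]; rewrite ?eqY; first exact: minX.
by apply: maxY; rewrite sV eqV eqY eqxx.
Qed.

Section OptimalTheory.
Variables (t t' : T) (Z1 Z2 X : {set E}).
Hypotheses (Z2t' : Z2 \subset pre [set t']) (optX : optimal t t' Z1 Z2 X).

Lemma separatesU S : t' \notin S -> separates Z1 Z2 (X :|: pre S).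
Proof.
move=> t'S; have [/andP[sZ1 sZ2] _ _] := optX; apply/andP; split.
  exact: subset_trans sZ1 (subsetUl _ _).
rewrite setCU subsetI sZ2 -td_preimC; apply: subset_trans Z2t' _.
by apply: td_preimS; rewrite sub1set inE.
Qed.

Lemma optimal_connU S : t' \notin S -> conn M X <= conn M (X :|: pre S).
Proof. by move=> /separatesU; have [_ minX _] := optX => /minX. Qed.

(* Otherwise [X :|: pre W] would be a minimizer crossing fewer branches off the path. *)
Lemma optimal_uncrossed F S : let W := ~: stem F t' in
  F \in stars T -> conn M (X :|: pre W) <= conn M X ->
  S \in off_path t t' -> S \subset W -> uncrossed X S.
Proof.
move=> W Fs leW offS subS; apply: contraT => crossS.
have t'W : t' \notin W by rewrite inE negbK mem_stem.
have eqW : conn M (X :|: pre W) = conn M X.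
  by apply/eqP; rewrite eq_le leW optimal_connU.
have [_ _ maxX] := optX; have := maxX _ (separatesU t'W) eqW.
rewrite leqNgt => /negP[]; apply/proper_card/properP; split; last first.
  exists S; rewrite inE offS //=.
  by apply/orP; left; apply: subsetU; rewrite td_preimS ?orbT.
apply/subsetP => R; rewrite !in_set => /andP[/andP[Rb /andP[tR t'R]] uncR].
rewrite Rb tR t'R /=; case/orP: uncR => [subX|subX].
  by apply/orP; left; apply: subset_trans subX (subsetUl _ _).
have [sW|dW|Ws] := branch_laminar Fs Rb t'R.
- by apply/orP; left; apply: subsetU; rewrite td_preimS ?orbT.
- apply/orP; right; rewrite setCU subsetI subX -td_preimC td_preimS //.
  by rewrite -disjoints_subset.
- case/orP: crossS; right; apply: subset_trans subX.
  by apply: td_preimS; apply: subset_trans subS Ws.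
Qed.

Lemma push_width_le F : F \in stars T -> push_width M t' X F <= star_width M F.
Proof.
move=> Fs; have t'W : t' \notin ~: stem F t' by rewrite inE negbK mem_stem.
have := push_width_exchange M t' X (star_trivIset Fs).
by have := optimal_connU t'W; lia.
Qed.

Lemma push_width_tight F : F \in stars T -> push_width M t' X F = star_width M F ->
  push_width M t' X F <= conn M X \/ push_width M t (~: X) F <= conn M X.
Proof.
move=> Fs tight; have trivF := star_trivIset Fs.
have leW : conn M (X :|: pre (~: stem F t')) <= conn M X.
  by have := push_width_exchange M t' X trivF; lia.
have Fb C : C \in F -> C \in branches T by apply/subsetP/star_branches.
have X0 := conn_ge0 M X.
have [/existsP[C /and3P[CF tC t'C]]|on_path] :=
  boolP [exists C, [&& C \in F, t \in C & t' \in C]].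
  have offC : ~: C \in off_path t t' by rewrite !inE tC t'C branchC ?Fb.
  have : uncrossed X (~: C).
    by apply: optimal_uncrossed Fs leW offC _; rewrite (stem_block trivF CF t'C).
  case/orP=> sub; [right|left]; apply: le_trans X0; apply: push_width_le0 CF _ _ => //.
  by rewrite setCK.
right; have := @push_width_add_le _ M _ t t' X F trivF; rewrite tight => sum_le.
suff: star_width M F + push_width M t (~: X) F <= star_width M F + conn M X by lia.
apply: sum_le => [C CF tC|C CF tC t'C].
  by apply: contraNN on_path => t'C; apply/existsP; exists C; rewrite CF tC.
apply: optimal_uncrossed Fs leW _ (block_sub_stemC trivF CF t'C).
by rewrite inE Fb // tC.
Qed.

End OptimalTheory.
End OptimalSeparation.

(** * Comparing decompositions *)

Definition colex_lt (f g : nat -> nat) : Prop :=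
  exists2 q, (f q < g q)%N & forall p, (q < p)%N -> (f p <= g p)%N.

Lemma colex_min (U : Type) (P : U -> Prop) (c : U -> nat -> nat) (n : nat) :
  (forall u v p, P u -> P v -> (n <= p)%N -> c u p = c v p) -> (exists u, P u) ->
  exists2 u, P u & forall v, P v -> ~ colex_lt (c v) (c u).
Proof.
elim: n P => [|n IHn] P agree [u Pu].
  by exists u => // v Pv [q]; rewrite (agree v u) ?ltnn.
have ex_value : exists m, `[< exists2 v, P v & c v n = m >].
  by exists (c u n); apply/asboolP; exists u.
case: (ex_minnP ex_value) => m /asboolP[v Pv cv] min_m.
have [w w' p [Pw cw] [Pw' cw']||w [Pw cw] min_w] := IHn (fun w => P w /\ c w n = m).
- by rewrite leq_eqVlt => /orP[/eqP <-|/agree]; [rewrite cw cw'|apply].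
- by exists v.
have min_n w' : P w' -> (m <= c w' n)%N.
  by move=> Pw'; apply: min_m; apply/asboolP; exists w'.
exists w => // w' Pw' [q lt_q le_q]; case: (ltngtP q n) => [qn|nq|eq_qn].
- apply: (min_w w'); last by exists q.
  by split=> //; apply/eqP; rewrite eqn_leq min_n // -{1}cw le_q.
- by rewrite (agree w' w) ?ltnn in lt_q.
- by move: lt_q; rewrite eq_qn cw ltnNge min_n.
Qed.

Definition count_ge (I : finType) (A : {set I}) (f : I -> int) (p : nat) : nat :=
  #|[set z in A | p%:Z <= f z]|.

(* With [q] the largest weight that drops in both copies, every index of weight at
   least [q] has at most one copy of weight at least [q]. *)
Lemma count_ge_colex_lt (I I' : finType) (A : {set I}) (A' : {set I'})
    (f : I -> int) (f' : I' -> int) (copy : bool -> I -> I') (k : nat) :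
  (forall z, z \in A' -> k%:Z <= f' z -> exists b x, x \in A /\ z = copy b x) ->
  (forall b x, x \in A -> f' (copy b x) <= f x) ->
  (forall x, x \in A -> k%:Z <= f x ->
    (forall b, f' (copy b x) < f x) \/ exists b, f' (copy b x) < k%:Z) ->
  (exists2 x, x \in A & k%:Z <= f x /\ forall b, f' (copy b x) < f x) ->
  colex_lt (count_ge A' f') (count_ge A f).
Proof.
move=> onto le_f drop [x1 Ax1 [kx1 drop1]].
pose drops x := [&& x \in A, k%:Z <= f x & [forall b, f' (copy b x) < f x]].
have drops1 : drops x1 by rewrite /drops Ax1 kx1; apply/forallP.
have [x0 /and3P[Ax0 kx0 /forallP drop0] max_x0] := arg_maxnP (fun x => `|f x|%N) drops1.
pose big_copy p x := [exists b, p%:Z <= f' (copy b x)].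
have le_copies p : (`|f x0| <= p)%N ->
    (count_ge A' f' p <= #|[set x in A | big_copy p x]|)%N.
  move=> qp; pose sel x := copy (p%:Z <= f' (copy true x)) x.
  apply: leq_trans (leq_imset_card sel _); apply/subset_leq_card/subsetP => z.
  rewrite inE => /andP[Az pz].
  have [|b [x [Ax def_z]]] := onto z Az; first by lia.
  rewrite {z}def_z in Az pz *; apply/imsetP; exists x.
    by rewrite inE Ax; apply/existsP; exists b.
  rewrite /sel; congr copy; case: b {Az} pz => pz; first by rewrite pz.
  apply/esym/negP => pt; have kx : k%:Z <= f x by have := le_f true x Ax; lia.
  have [lt|[[] lt]] := drop x Ax kx; [|lia..].
  have /max_x0 : drops x by rewrite /drops Ax kx; apply/forallP.
  by have := lt true; rewrite /=; lia.
have sub_A p : [set x in A | big_copy p x] \subset [set x in A | p%:Z <= f x].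
  apply/subsetP => x; rewrite !inE => /andP[Ax /existsP[b /le_trans]].
  by rewrite Ax; apply; apply: le_f.
exists `|f x0|%N => [|p qp].
  apply: leq_ltn_trans (le_copies _ (leqnn _)) _; apply/proper_card/properP.
  split=> //; exists x0; rewrite !inE Ax0 /=; first by lia.
  by apply/existsPn => b; have := drop0 b; lia.
exact: leq_trans (le_copies _ (ltnW qp)) (subset_leq_card (sub_A p)).
Qed.

Section StarCount.
Variables (E : finType) (M : matroid E).
Implicit Type D : tree_decomposition E.

Definition star_count D : nat -> nat := count_ge (stars (td_tree D)) (@star_width E M D).

Lemma star_width_le_width D F : F \in stars (td_tree D) -> star_width M F <= width M D.
Proof.
have le_w := (widthP M D).1; case/starsP=> [[v ->]|[S Sb ->]].
  by rewrite -vertex_widthE.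
rewrite edge_star_width ?branch_neqC //; have /branchesP[x [y [xy ->]]] := Sb.
exact: le_trans (conn_le_vertex_width M xy) (le_w x).
Qed.

Lemma star_count_gt_width D (p : nat) : width M D < p%:Z -> star_count D p = 0%N.
Proof.
move=> ltp; apply: eq_card0 => F; rewrite in_set; apply/negP => /andP[Fs].
by have := star_width_le_width Fs; lia.
Qed.

Lemma star_count_min : exists2 D, width M D = (tw M)%:Z &
  forall D', width M D' <= (tw M)%:Z -> ~ colex_lt (star_count D') (star_count D).
Proof.
have [[D0 wD0] tw_min] := twP M.
have [||D wD minD] := @colex_min _ (fun D => width M D <= (tw M)%:Z) star_count (tw M).+1.
- by move=> D1 D2 p w1 w2 ltp; rewrite !star_count_gt_width //; lia.
- by exists D0; rewrite wD0.
by exists D => //; apply/eqP; rewrite eq_le wD tw_min.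
Qed.

End StarCount.

(** * Splitting a decomposition along a separation *)

Section Split.
Variables (E : finType) (M : matroid E) (D : tree_decomposition E).
Variables (t t' : td_tree D) (X : {set E}).
Implicit Types (b : bool) (v x y : td_tree D) (C : {set td_tree D}).

Definition side b : {set E} := if b then ~: X else X.

(* The copy carrying [X] is attached at [t'], where [~: X] is concentrated, and
   conversely. *)
Definition anchor b : td_tree D := if b then t else t'.

Definition split_td : tree_decomposition E :=
  @TreeDecomposition E (glue anchor) (fun e => (td_map D e, e \notin X)).

Lemma mem_side b e : (e \in side b) = ((e \notin X) == b).
Proof. by case: b; rewrite /side ?inE; case: (e \in X). Qed.

Lemma sideC b : ~: side b = side (~~ b).
Proof. by case: b; rewrite /side ?setCK. Qed.

Lemma conn_side b : conn M (side b) = conn M X.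
Proof. by case: b; rewrite /side ?connC. Qed.

Lemma split_preim_lift b C :
  @td_preim E split_td (glue_lift anchor b C) = push (anchor b) (side b) C.
Proof.
apply/setP => e; rewrite inE [X in X = _]inE /= /push.
by case: ifP => sb; case: ifP => aC; rewrite !inE mem_side sb ?andbT ?andbF ?orbF ?orbT.
Qed.

Lemma split_preim_copy b : @td_preim E split_td (glue_copy anchor b) = side b.
Proof. by apply/setP => e; rewrite !inE mem_side. Qed.

Lemma split_star_width b F : F \in stars (td_tree D) ->
  @star_width E M split_td (glue_star anchor b F) = push_width M (anchor b) (side b) F.
Proof.
move=> Fs; have sum_lift : \sum_(C in glue_lift anchor b @: F)
      deficit M (@td_preim E split_td C) =
    \sum_(C in F) deficit M (push (anchor b) (side b) C).
  rewrite big_imset; last by move=> C C' _ _; apply: glue_lift_inj.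
  by apply: eq_bigr => C _; rewrite split_preim_lift.
rewrite /star_width /push_width /glue_star; case: ifP => _.
  by rewrite setU0 sum_lift subr0.
rewrite setUC big_setU1 ?glue_copy_notin //= sum_lift split_preim_copy sideC.
by rewrite opprD addrA addrAC.
Qed.

Lemma split_vertex_width b v : @vertex_width E M split_td (v, b) =
  @star_width E M split_td (glue_star anchor b (components v)).
Proof. by rewrite vertex_widthE glue_components. Qed.

Lemma split_edge_width_le b x y : adj x y -> let C := component x y in
  @star_width E M split_td (glue_star anchor b [set C; ~: C]) <=
  @vertex_width E M split_td (x, b).
Proof.
move=> xy /=; have xy_b : @adj (td_tree split_td) (x, b) (y, b).
  by rewrite /= glue_adj_copy.
rewrite glue_edge_star -glue_component 1?eq_sym ?adj_neq //.
rewrite edge_star_width ?branch_neqC ?branch_component //.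
exact: conn_le_vertex_width.
Qed.

Lemma split_starsP G : G \in stars (td_tree split_td) -> conn M X < star_width M G ->
  exists b F, F \in stars (td_tree D) /\ G = glue_star anchor b F.
Proof.
case/glue_starsP => [//|[b ->]].
have neqC : glue_copy anchor b != ~: glue_copy anchor b.
  by apply/eqP/setP => /(_ (t, b)); rewrite !inE /= eqxx.
by rewrite edge_star_width // split_preim_copy conn_side ltxx.
Qed.

Lemma rank_le_split_width b (Z : {set E}) v :
  Z \subset td_preim [set v] -> Z \subset side b ->
  (rank M Z)%:Z <= @vertex_width E M split_td (v, b).
Proof.
move=> /subsetP Zv /subsetP Zs; rewrite vertex_widthE.
apply: rank_le_star_width (components_trivIset _) _; rewrite cover_components setCK.
apply/subsetP => e eZ; have := Zv e eZ; have := Zs e eZ.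
by rewrite mem_side !inE xpair_eqE => -> ->.
Qed.

End Split.

Section Improve.
Variables (E : finType) (M : matroid E) (D : tree_decomposition E).
Variables (k : nat) (t t' : td_tree D) (Z1 Z2 X : {set E}).
Hypotheses (Z1t : Z1 \subset td_preim [set t]) (Z2t' : Z2 \subset td_preim [set t']).
Hypothesis optX : optimal M t t' Z1 Z2 X.

Let D' := split_td t t' X.
Let copy b (F : {set {set td_tree D}}) : {set {set td_tree D'}} :=
  glue_star (anchor t t') b F.

Let optimal_anchor b : optimal M (anchor t t' (~~ b)) (anchor t t' b)
  (if b then Z2 else Z1) (if b then Z1 else Z2) (side X b).
Proof. by case: b => //; apply: optimal_sym. Qed.

Let anchor_sub b : (if b then Z1 else Z2) \subset td_preim [set anchor t t' b].
Proof. by case: b. Qed.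

Lemma split_star_width_le b F : F \in stars (td_tree D) ->
  star_width M (copy b F) <= star_width M F.
Proof.
move=> Fs; rewrite split_star_width //.
exact: push_width_le (anchor_sub b) (optimal_anchor b) _ Fs.
Qed.

Lemma split_star_drop F : F \in stars (td_tree D) ->
  (forall b, star_width M (copy b F) < star_width M F) \/
  exists b, star_width M (copy b F) <= conn M X.
Proof.
move=> Fs; have [/existsP[b tight]|/existsPn lt] :=
    boolP [exists b, star_width M F <= star_width M (copy b F)]; last first.
  by left=> b; rewrite ltNge.
right; have {}tight : star_width M (copy b F) = star_width M F.
  by apply/eqP; rewrite eq_le tight split_star_width_le.
rewrite split_star_width // in tight.
have := push_width_tight (anchor_sub b) (optimal_anchor b) Fs tight.
rewrite conn_side sideC => -[]; [exists b|exists (~~ b)]; by rewrite split_star_width.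
Qed.

Lemma split_width_le : width M D' <= width M D.
Proof.
apply/bigmax_leP; split=> [|[v b] _]; first exact: width_ge0.
rewrite split_vertex_width; apply: le_trans (star_width_le_width _ (components_star v)).
exact/split_star_width_le/components_star.
Qed.

Hypotheses (rZ1 : rank M Z1 = k) (rZ2 : rank M Z2 = k) (ltX : conn M X < k%:Z).
Hypothesis thick : forall s s', edge_on_path t t' s s' ->
  k%:Z <= conn M (td_preim (component s' s)).

Let small b v : bool := @vertex_width E M D' (v, b) <= conn M X.

Lemma small_switch :
  (forall v, k%:Z <= vertex_width M v -> exists b, small b v) ->
  exists u v, [/\ edge_on_path t t' u v, adj u v, small true u & small false v].
Proof.
move=> ex_small; have [/andP[Z1X Z2X] _ _] := optX.
have split_le b v : @vertex_width E M D' (v, b) <= vertex_width M v.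
  by rewrite split_vertex_width vertex_widthE split_star_width_le ?components_star.
have large_t : k%:Z <= @vertex_width E M D' (t, false).
  by rewrite -rZ1 rank_le_split_width.
have large_t' : k%:Z <= @vertex_width E M D' (t', true).
  by rewrite -rZ2 rank_le_split_width.
have small_t : small true t.
  have [|[] //] := ex_small t; first exact: le_trans large_t (split_le _ _).
  by rewrite /small => /(le_trans large_t); rewrite leNgt ltX.
have [p [tp up def_t']] := tree_path_ex t t'.
have not_small_t' : ~~ small true (last t p).
  by rewrite def_t' /small -ltNge (lt_le_trans ltX).
have [u [v [uv_p uv small_u not_small_v]]] := path_exit tp small_t not_small_t'.
have uv_path : edge_on_path t t' u v by exists p.
exists u, v; split=> //; have vu : adj v u by rewrite adj_sym.
have [|[] //] := ex_small v; last by move/negP: not_small_v.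
exact: le_trans (thick uv_path) (conn_le_vertex_width M vu).
Qed.

Lemma split_edge_width_small u v : adj u v -> small true u -> small false v ->
  let S := component v u in forall b, star_width M (copy b [set S; ~: S]) <= conn M X.
Proof.
move=> uv small_u small_v /=; have vu : adj v u by rewrite adj_sym.
have edgeC :
    [set component u v; ~: component u v] = [set component v u; ~: component v u].
  by rewrite (componentC vu) setCK setUC.
case; last exact: le_trans (split_edge_width_le M t t' X _ vu) small_v.
by rewrite -edgeC; apply: le_trans (split_edge_width_le M t t' X _ uv) small_u.
Qed.

(* If no vertex shrinks in both copies, then each vertex of the path is small in
   one copy; where the small copy changes, the edge between shrinks in both. *)
Lemma split_star_shrinks : exists2 F, F \in stars (td_tree D) &
  k%:Z <= star_width M F /\ forall b, star_width M (copy b F) < star_width M F.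
Proof.
apply: contrapT => none.
have [v kv|u [v [uv_path uv small_u small_v]]] := small_switch.
  rewrite vertex_widthE in kv; have [lt|[b le]] := split_star_drop (components_star v).
    by case: none; exists (components v) => //; apply: components_star.
  by exists b; rewrite /small split_vertex_width.
pose S := component v u.
have Sb : S \in branches (td_tree D) by rewrite branch_component // adj_sym.
case: none; exists [set S; ~: S]; first exact: edge_star.
have k_uv := thick uv_path; rewrite edge_star_width ?branch_neqC //.
split=> // b; apply: lt_le_trans k_uv; apply: le_lt_trans ltX.
exact: split_edge_width_small.
Qed.

Lemma split_star_count_lt : colex_lt (star_count M D') (star_count M D).
Proof.
apply: (@count_ge_colex_lt _ _ _ _ _ _ copy k).
- by move=> G Gs kG; apply: split_starsP Gs (lt_le_trans ltX kG).
- exact: split_star_width_le.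
- move=> F Fs _; have [lt|[b le]] := split_star_drop Fs; first by left.
  by right; exists b; apply: le_lt_trans ltX.
- exact: split_star_shrinks.
Qed.

End Improve.

Theorem theorem5p14 (E : finType) (M : matroid E) :
  exists D : tree_decomposition E, lean M D /\ width M D = Posz (tw M).
Proof.
have [D wD minD] := star_count_min M; exists D; split=> //.
move=> k t t' Z1 Z2 Z1t Z2t' rZ1 rZ2.
have [|/conn2_lt[X0 sX0 ltX0]] := boolP (k%:Z%:E <= conn2 M Z1 Z2)%E; [by left|right].
apply: contrapT => none; have [X optX leX] := optimal_ex M t t' sX0.
have thick s s' : edge_on_path t t' s s' -> k%:Z <= conn M (td_preim (component s' s)).
  by move=> ss'; rewrite leNgt; apply/negP => lt; apply: none; exists s, s'.
apply: (minD (split_td t t' X)).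
  by rewrite -wD; apply: split_width_le Z1t Z2t' optX.
exact: split_star_count_lt Z1t Z2t' optX rZ1 rZ2 (le_lt_trans leX ltX0) thick.
Qed.
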